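(* Let $G$ be an ordered group, let $H\le G$ be a subgroup which is a module of the ordered set $G$, let $K\le G$ be a subgroup, and put $L:=H\cap K$. Then: (a) $L$ is a convex subgroup of $K$ and a module of the induced order on $K$. (b) For every $k\in K$, $K\cap kH=kL$ and $K\cap Hk=Lk$. Thus every left $H$-coset met by $K$ is met in exactly one left $L$-coset, and similarly on the right. (c) The map $kL\mapsto kH$ is an order isomorphism from the set of left $L$-cosets of $K$, with the quotient order induced by their modular partition, onto the subposet of the left $H$-coset quotient of $G$ induced by the cosets that meet $K$. Consequently the order on $K$ is the lexicographical sum of copies of $L$ indexed by that induced subposet. (d) If, in addition, $H\triangleleft G$, then $L\triangleleft K$, and the natural map $K/L\to G/H$, $kL\mapsto kH$, is an embedding of ordered groups with image $KH/H$.
   Context: An ordered group is a group $G$ equipped with a partial order $\le$ such that $x\le y$ implies $axb\le ayb$ for all $a,b,x,y\in G$. A module of a poset $X$ is a subset $M$ such that for every $x\in X\setminus M$ and $m,m'\in M$: $x\le m\iff x\le m'$ and $m\le x\iff m'\le x$. Every module of a poset is convex ($a\le z\le b$ with $a,b$ in it implies $z$ in it). If a poset is partitioned into nonempty modules (a modular partition), the quotient order on the set of blocks is: for distinct blocks $A,B$, $A<B$ iff $a<b$ for some (equivalently all) $a\in A$, $b\in B$. For a subgroup $H$ that is a module of $G$, the left cosets of $H$ form a modular partition of $G$, and the left $H$-coset quotient of $G$ is the set of left cosets with this order; similarly for the left $L$-cosets in $K$. For a convex normal subgroup $N$ of an ordered group $P$, $P/N$ is the ordered group with order $\alpha\le\beta$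 iff $a\le b$ for some $a\in\alpha$, $b\in\beta$. The lexicographical sum of posets $(X_i,\le_i)$, pairwise disjoint and nonempty, indexed by a poset $I$ is $\bigcup_i X_i$ with $x\le y$ (for $x\in X_i,y\in X_j$) iff either $i=j$ and $x\le_i y$, or $i\ne j$ and $i<j$ in $I$. An embedding of ordered groups is an injective homomorphism that preserves and reflects the order. *)

(* Defs.v *)
From HB Require Import structures.
From mathcomp Require Import all_boot all_order.
From mathcomp Require Import boolp classical_sets.

Set Implicit Arguments.
Unset Strict Implicit.
Unset Printing Implicit Defensive.

Import Order.TTheory.
Local Open Scope order_scope.
Local Open Scope group_scope.
Local Open Scope classical_set_scope.

HB.mixin Record POrder_isOrderedGroup d G of Group G & Order.POrder d G := {
  mulg_mono : forall a b x y : G, x <= y -> a * x * b <= a * y * b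
}.

#[short(type="ogroupType")]
HB.structure Definition OrderedGroup d :=
  {G of Group G & Order.POrder d G & POrder_isOrderedGroup d G}.

(* The elements of A with the order induced by T.  This is a separate name
   because for P : set (set T) the inclusion order on set T must not be
   inherited by the type of blocks of P. *)
Definition subposet d (T : porderType d) (A : set T) : Type := set_type A.

Section SubPoset.
Context {d : Order.disp_t} {T : porderType d} (A : set T).
HB.instance Definition _ := SubChoice.copy (subposet A) (set_type A).
HB.instance Definition _ := [SubChoice_isSubPOrder of subposet A by <: with d].
End SubPoset.

Section Posets.
Context {d : Order.disp_t} {T : porderType d}.
Implicit Types X M : set T.

(* Relative to the subposet X. *)
Definition convex X M : Prop :=
  forall a b z : T, M a -> M b -> X z -> a <= z -> z <= b -> M z.

Definition is_module X M : Prop :=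
  M `<=` X /\
  forall x m m' : T, (X `\` M) x -> M m -> M m' ->
    (x <= m <-> x <= m') /\ (m <= x <-> m' <= x).

Definition modular_partition X (P : set (set T)) : Prop :=
  partition P id X /\ forall A, P A -> is_module X A.

Definition block_quotient X P of modular_partition X P : Type := set_type P.

(* S is the union of the pairwise disjoint nonempty sets Y i, each with the
   induced order, and its order is the lexicographical one. *)
Definition is_lexicographical_sum (S : set T) d' (I : porderType d')
    (Y : I -> set T) : Prop :=
  [/\ forall i, Y i !=set0,
      trivIset setT Y,
      \bigcup_i Y i = S &
      forall i j x y, Y i x -> Y j y ->
        (x <= y <-> (i = j /\ x <= y) \/ (i <> j /\ i < j))].

End Posets.

Definition order_isomorphism d (T : porderType d) d' (U : porderType d')
    (f : T -> U) : Prop :=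
  bijective f /\ {mono f : x y / x <= y}.

Section BlockQuotient.
Context {d : Order.disp_t} {T : porderType d} {X : set T} {P : set (set T)}.
Variable mP : modular_partition X P.
Local Notation Q := (block_quotient mP).

HB.instance Definition _ := SubChoice.copy Q (set_type P).

Definition block_lt (A B : Q) : bool :=
  (A != B) && `[< exists a b, [/\ val A a, val B b & a < b] >].

Lemma block_eq (A B : Q) (x : T) : val A x -> val B x -> A = B.
Proof.
move=> Ax Bx; have [[_ tP _] _] := mP; apply/val_inj/tP.
- exact: set_mem (valP A).
- exact: set_mem (valP B).
by exists x.
Qed.

Lemma block_sub (A : Q) (x : T) : val A x -> X x.
Proof.
have [_ mA] := mP; have [sub _] := mA _ (set_mem (valP A)); exact: sub.
Qed.

Lemma block_lt_all (A B : Q) : block_lt A B ->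
  forall a b, val A a -> val B b -> a < b.
Proof.
case/andP=> /eqP AB /asboolP[a0 [b0 [Aa0 Bb0 lt0]]] a b Aa Bb.
have [_ mo] := mP.
have [_ mA] := mo _ (set_mem (valP A)); have [_ mB] := mo _ (set_mem (valP B)).
have nA : (X `\` val A) b by split; [exact: block_sub Bb
  | move=> Ab; exact: AB (block_eq Ab Bb)].
have nB : (X `\` val B) a0 by split; [exact: block_sub Aa0
  | move=> Ba; exact: AB (block_eq Aa0 Ba)].
have [m1 _] := mB _ _ _ nB Bb0 Bb.
have [_ m2] := mA _ _ _ nA Aa0 Aa.
rewrite lt_neqAle (m2.1 (m1.1 (ltW lt0))) andbT; apply/eqP => ab.
by apply: AB; apply: (block_eq Aa); rewrite ab.
Qed.

Lemma block_lt_irr : irreflexive block_lt.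
Proof. by move=> A; rewrite /block_lt eqxx. Qed.

Lemma block_lt_trans : transitive block_lt.
Proof.
move=> B A C AB BC.
have [a [b [Aa Bb _]]] : exists a b, [/\ val A a, val B b & a < b].
  by case/andP: AB => _ /asboolP.
have [_ [c [_ Cc _]]] : exists b c, [/\ val B b, val C c & b < c].
  by case/andP: BC => _ /asboolP.
have ab := block_lt_all AB Aa Bb; have bc := block_lt_all BC Bb Cc.
apply/andP; split; last by apply/asboolP; exists a, c; split=> //; exact: lt_trans bc.
apply/eqP => eAC; have := block_lt_all AB; rewrite eAC => /(_ _ _ Cc Bb) cb.
by have := lt_trans bc cb; rewrite ltxx.
Qed.

HB.instance Definition _ := Order.Lt_isPOrder.Build d Q block_lt_irr block_lt_trans.

End BlockQuotient.

Section Subgroups.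
Context {G : groupType}.
Implicit Types (P N A B : set G) (x : G).

Definition lcoset x A : set G := [set x * a | a in A].
Definition rcoset A x : set G := [set a * x | a in A].
Definition lcosets P A : set (set G) := [set lcoset x A | x in P].
Definition rcosets P A : set (set G) := [set rcoset A x | x in P].
Definition setmulg A B : set G := [set a * b | a in A & b in B].
Definition setinvg A : set G := [set a^-1 | a in A].

Definition subgroup P N : Prop := N `<=` P /\ group_closed [in N].

Definition normal_subgroup P N : Prop :=
  subgroup P N /\ forall x n, P x -> N n -> N (n ^ x).

End Subgroups.

Section OrderedQuotient.
Context {d : Order.disp_t} {G : ogroupType d}.

Definition convex_normal_subgroup (P N : set G) : Prop :=
  [/\ subgroup setT P, normal_subgroup P N & convex P N].

Context {P N : set G}.

Definition ordered_quotient of convex_normal_subgroup P N : Type :=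
  set_type (lcosets P N).

Variable cN : convex_normal_subgroup P N.
Local Notation Q := (ordered_quotient cN).

HB.instance Definition _ := SubChoice.copy Q (set_type (lcosets P N)).

Let P1 : P 1.
Proof. by case: (cN) => -[_ []] /set_mem. Qed.
Let PM x y : P x -> P y -> P (x * y).
Proof.
case: (cN) => -[_ /group_closedM cl] _ _ Px Py.
by apply/set_mem/cl; exact/mem_set.
Qed.
Let PV x : P x -> P x^-1.
Proof.
case: (cN) => -[_ /group_closedV cl] _ _ Px.
by apply/set_mem/cl; exact/mem_set.
Qed.
Let N1 : N 1.
Proof. by case: (cN) => _ [[_ []]] /set_mem. Qed.
Let NM x y : N x -> N y -> N (x * y).
Proof.
case: (cN) => _ [[_ /group_closedM cl] _] _ Px Py.
by apply/set_mem/cl; exact/mem_set.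
Qed.
Let NV x : N x -> N x^-1.
Proof.
case: (cN) => _ [[_ /group_closedV cl] _] _ Px.
by apply/set_mem/cl; exact/mem_set.
Qed.
Let NP x : N x -> P x.
Proof. by case: (cN) => _ [[sub _] _] _; exact: sub. Qed.
Let NJ x n : P x -> N n -> N (n ^ x).
Proof. by case: (cN) => _ [_ cj] _; exact: cj. Qed.

Lemma lcosetE x y : lcoset x N y <-> N (x^-1 * y).
Proof.
split=> [[n Nn <-]|Ny]; first by rewrite mulKg.
by exists (x^-1 * y) => //; rewrite mulVKg.
Qed.

Lemma eq_lcoset x y : N (x^-1 * y) -> lcoset x N = lcoset y N.
Proof.
move=> Nxy; apply/seteqP; split=> z /lcosetE Nz; apply/lcosetE.
  have -> : y^-1 * z = (x^-1 * y)^-1 * (x^-1 * z) by rewrite invgM invgK -mulgA mulVKg.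
  exact: NM (NV Nxy) Nz.
have -> : x^-1 * z = (x^-1 * y) * (y^-1 * z) by rewrite -mulgA mulVKg.
exact: NM.
Qed.

Lemma setmulg_lcoset x y : P x -> P y ->
  setmulg (lcoset x N) (lcoset y N) = lcoset (x * y) N.
Proof.
move=> Px Py; apply/seteqP; split=> z.
  case=> _ [n Nn <-] [_ [m Nm <-] <-]; exists (n ^ y * m); first exact: NM (NJ _ _) _.
  by rewrite /conjg !mulgA mulgK.
case=> n Nn <-; exists x; first by exists 1; rewrite ?mulg1.
by exists (y * n); [exists n | rewrite mulgA].
Qed.

Lemma setinvg_lcoset x : P x -> setinvg (lcoset x N) = lcoset x^-1 N.
Proof.
move=> Px; apply/seteqP; split=> z.
  case=> _ [n Nn <-] <-; apply/lcosetE; rewrite invgK invgM.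
  have -> : x * (n^-1 * x^-1) = n^-1 ^ x^-1 by rewrite /conjg invgK.
  exact: NJ (PV Px) (NV Nn).
case=> n Nn <-; exists (x^-1 * n)^-1; last by rewrite invgK.
apply/lcosetE; rewrite invgM invgK.
have -> : x^-1 * (n^-1 * x) = n^-1 ^ x by [].
exact: NJ Px (NV Nn).
Qed.

Lemma quotient_repr (A : Q) : exists2 x, P x & val A = lcoset x N.
Proof. by have [x Px <-] := set_mem (valP A); exists x. Qed.

Fact quotient_one_subproof : lcosets P N N.
Proof.
exists 1 => //; apply/seteqP; split=> z; first by case=> n Nn <-; rewrite mul1g.
by move=> Nz; exists z => //; rewrite mul1g.
Qed.

Fact quotient_mul_subproof (A B : Q) : lcosets P N (setmulg (val A) (val B)).
Proof.
have [[x Px ->] [y Py ->]] := (quotient_repr A, quotient_repr B).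
by rewrite setmulg_lcoset //; exists (x * y) => //; exact: PM.
Qed.

Fact quotient_inv_subproof (A : Q) : lcosets P N (setinvg (val A)).
Proof.
have [x Px ->] := quotient_repr A.
by rewrite setinvg_lcoset //; exists x^-1 => //; exact: PV.
Qed.

Definition quotient_one : Q := exist _ N (mem_set quotient_one_subproof).
Definition quotient_mul (A B : Q) : Q :=
  exist _ (setmulg (val A) (val B)) (mem_set (quotient_mul_subproof A B)).
Definition quotient_inv (A : Q) : Q :=
  exist _ (setinvg (val A)) (mem_set (quotient_inv_subproof A)).
Definition quotient_le (A B : Q) : bool :=
  `[< exists a b, [/\ val A a, val B b & a <= b] >].

Lemma val_quotient_one : val quotient_one = lcoset 1 N.
Proof.
rewrite /=; apply/seteqP; split=> z; last by case=> n Nn <-; rewrite mul1g.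
by move=> Nz; exists z => //; rewrite mul1g.
Qed.

Lemma val_quotient_mul A B : val (quotient_mul A B) = setmulg (val A) (val B).
Proof. by []. Qed.

Lemma val_quotient_inv A : val (quotient_inv A) = setinvg (val A).
Proof. by []. Qed.

Lemma quotient_mulA : associative quotient_mul.
Proof.
move=> A B C; apply: val_inj; rewrite !val_quotient_mul.
have [[x Px ->] [y Py ->]] := (quotient_repr A, quotient_repr B).
have [z Pz ->] := quotient_repr C.
by rewrite !setmulg_lcoset ?mulgA //; exact: PM.
Qed.

Lemma quotient_mul1 : left_id quotient_one quotient_mul.
Proof.
move=> A; apply: val_inj; rewrite val_quotient_mul val_quotient_one.
have [x Px ->] := quotient_repr A.
by rewrite setmulg_lcoset ?mul1g.
Qed.

Lemma quotient_mulr1 : right_id quotient_one quotient_mul.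
Proof.
move=> A; apply: val_inj; rewrite val_quotient_mul val_quotient_one.
have [x Px ->] := quotient_repr A.
by rewrite setmulg_lcoset ?mulg1.
Qed.

Lemma quotient_mulV : left_inverse quotient_one quotient_inv quotient_mul.
Proof.
move=> A; apply: val_inj.
rewrite val_quotient_mul val_quotient_inv val_quotient_one.
have [x Px ->] := quotient_repr A.
by rewrite setinvg_lcoset // setmulg_lcoset ?mulVg //; exact: PV.
Qed.

Lemma quotient_mulrV : right_inverse quotient_one quotient_inv quotient_mul.
Proof.
move=> A; apply: val_inj.
rewrite val_quotient_mul val_quotient_inv val_quotient_one.
have [x Px ->] := quotient_repr A.
by rewrite setinvg_lcoset // setmulg_lcoset ?mulgV //; exact: PV.
Qed.

HB.instance Definition _ := isGroup.Build Q
  quotient_mulA quotient_mul1 quotient_mulr1 quotient_mulV quotient_mulrV.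

Let leM (a x y : G) : x <= y -> a * x <= a * y.
Proof. by move/(mulg_mono a 1); rewrite !mulg1. Qed.

Let leMr (b x y : G) : x <= y -> x * b <= y * b.
Proof. by move/(mulg_mono 1 b); rewrite !mul1g. Qed.

Lemma quotient_leP x y (A B : Q) : P x -> P y ->
    val A = lcoset x N -> val B = lcoset y N ->
  reflect (exists2 n, N n & x <= y * n) (quotient_le A B).
Proof.
move=> Px Py eA eB; rewrite /quotient_le eA eB; apply: (iffP (asboolP _)).
  case=> _ [_ [[n Nn <-] [m Nm <-] le]]; exists (m * n^-1); first exact: NM _ (NV _).
  by have := leMr n^-1 le; rewrite mulgK mulgA.
case=> n Nn le; exists x, (y * n); split=> //; last by exists n.
by exists 1; rewrite ?mulg1.
Qed.

Lemma quotient_le_refl : reflexive quotient_le.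
Proof.
move=> A; have [x Px eA] := quotient_repr A.
by apply/(quotient_leP Px Px eA eA); exists 1; rewrite ?mulg1.
Qed.

Lemma quotient_le_trans : transitive quotient_le.
Proof.
move=> B A C; have [x Px eA] := quotient_repr A.
have [y Py eB] := quotient_repr B; have [z Pz eC] := quotient_repr C.
move=> /(quotient_leP Px Py eA eB)[n Nn xy] /(quotient_leP Py Pz eB eC)[m Nm yz].
apply/(quotient_leP Px Pz eA eC); exists (m * n); first exact: NM.
by rewrite mulgA; exact: le_trans xy (leMr _ yz).
Qed.

Lemma quotient_le_anti : antisymmetric quotient_le.
Proof.
move=> A B; have [x Px eA] := quotient_repr A; have [y Py eB] := quotient_repr B.
case/andP=> /(quotient_leP Px Py eA eB)[n Nn xy] /(quotient_leP Py Px eB eA)[m Nm yx].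
apply: val_inj; rewrite eA eB; apply: eq_lcoset.
have cvx : convex P N by case: (cN).
have le1 : n^-1 <= x^-1 * y.
  by have := leMr n^-1 (leM x^-1 xy); rewrite mulVg mul1g mulgA mulgK.
have le2 : x^-1 * y <= m by have := leM x^-1 yx; rewrite mulKg.
exact: cvx (NV Nn) Nm (PM (PV Px) Py) le1 le2.
Qed.

HB.instance Definition _ := Order.Le_isPOrder.Build d Q
  quotient_le_refl quotient_le_anti quotient_le_trans.

Lemma quotient_mulg_mono (A B X Y : Q) : X <= Y -> A * X * B <= A * Y * B.
Proof.
move/asboolP=> [x [y [Xx Yy xy]]].
have [[a Pa eA] [b Pb eB]] := (quotient_repr A, quotient_repr B).
have Aa : val A a by rewrite eA; exists 1; rewrite ?mulg1.
have Bb : val B b by rewrite eB; exists 1; rewrite ?mulg1.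
apply/asboolP; exists (a * x * b), (a * y * b); split; last exact: mulg_mono.
- by exists (a * x); [exists a => //; exists x | exists b].
- by exists (a * y); [exists a => //; exists y | exists b].
Qed.

HB.instance Definition _ := POrder_isOrderedGroup.Build d Q quotient_mulg_mono.

End OrderedQuotient.

Definition ogroup_embedding d (P : ogroupType d) d' (Q : ogroupType d')
    (f : P -> Q) : Prop :=
  [/\ injective f, {morph f : x y / x * y} & {mono f : x y / x <= y}].

(* Main.v *)
(** If k lies in K, then K meets kH in kL, where L is the intersection of H
    and K, so kL |-> kH and C |-> the trace of C on K are mutually inverse.
    Since H is a module, the order between two distinct cosets of H is decided
    by any pair of representatives, and these can be taken in K.  In (d), where
    the order of a quotient is "x <= y h for some h", take x, y in K and h in
    H: if y^-1 x is in H then xL = yL; otherwise y^-1 x <= h forces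
    y^-1 x <= 1 by modularity. *)

Require Import Defs.
From mathcomp Require Import all_boot all_order.
From mathcomp Require Import boolp classical_sets.

Set Implicit Arguments.
Unset Strict Implicit.
Unset Printing Implicit Defensive.

Import Order.TTheory.
Local Open Scope order_scope.
Local Open Scope group_scope.
Local Open Scope classical_set_scope.

(** * Cosets of a subgroup *)

Section SubgroupCosets.
Context {G : groupType} {P N : set G} (sN : subgroup P N).

Lemma subgroup_sub : N `<=` P.
Proof. by case: sN. Qed.

Lemma subgroup1 : N 1.
Proof. by case: sN => _ []/set_mem. Qed.

Lemma subgroupM x y : N x -> N y -> N (x * y).
Proof.
case: sN => _ /group_closedM cl Nx Ny.
by apply/set_mem/cl; exact/mem_set.
Qed.

Lemma subgroupV x : N x -> N x^-1.
Proof.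
by case: sN => _ /group_closedV cl Nx; apply/set_mem/cl; exact/mem_set.
Qed.

(** Trades the boolean membership in [group_closed] for membership in a set. *)
Lemma subgroup_intro : N `<=` P -> N 1 ->
  (forall x y, N x -> N y -> N (x / y)) -> subgroup P N.
Proof.
move=> NP N1 ND; split=> //; split; first exact/mem_set.
by move=> x y /set_mem Nx /set_mem Ny; exact/mem_set/ND.
Qed.

Lemma lcoset_refl x : lcoset x N x.
Proof. by exists 1; rewrite ?mulg1 //; exact: subgroup1. Qed.

Lemma lcoset_eq {x y} : lcoset x N y -> lcoset x N = lcoset y N.
Proof.
case=> n Nn <-; apply/seteqP; split=> _ [m Nm <-].
  exists (n^-1 * m); first exact: subgroupM (subgroupV _) _.
  by rewrite -mulgA mulVKg.
by exists (n * m); [exact: subgroupM | rewrite mulgA].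
Qed.

Lemma rcoset_eq {x y} : rcoset N x y -> rcoset N x = rcoset N y.
Proof.
case=> n Nn <-; apply/seteqP; split=> _ [m Nm <-].
  exists (m * n^-1); first exact: subgroupM _ (subgroupV _).
  by rewrite mulgA mulgVK.
by exists (m * n); [exact: subgroupM | rewrite mulgA].
Qed.

End SubgroupCosets.

(** * Traces on K of the cosets of H *)

Section SubgroupIntersection.
Context {G : groupType} {H K : set G}.
Context (subH : subgroup setT H) (subK : subgroup setT K).
Local Notation L := (H `&` K).

Lemma subgroupI : subgroup K L.
Proof.
apply: subgroup_intro => [x []//||x y [Hx Kx] [Hy Ky]].
  by split; [exact: subgroup1 subH | exact: subgroup1 subK].
split; first exact: (subgroupM subH) (subgroupV subH _).
exact: (subgroupM subK) (subgroupV subK _).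
Qed.

(** If [k] and [k * h] lie in K, then so does [h = k^-1 * (k * h)]. *)
Lemma setI_lcoset k : K k -> K `&` lcoset k H = lcoset k L.
Proof.
move=> Kk; apply/seteqP; split=> [x [Kx [h Hh eh]]|_ [h [Hh Kh] <-]].
  exists h => //; split=> //; rewrite -(mulKg k h) eh.
  exact: (subgroupM subK (subgroupV subK Kk)).
by split; [exact: (subgroupM subK) | exists h].
Qed.

Lemma setI_rcoset k : K k -> K `&` rcoset H k = rcoset L k.
Proof.
move=> Kk; apply/seteqP; split=> [x [Kx [h Hh eh]]|_ [h [Hh Kh] <-]].
  exists h => //; split=> //; rewrite -(mulgK k h) eh.
  exact: (subgroupM subK _ (subgroupV subK Kk)).
by split; [exact: (subgroupM subK) | exists h].
Qed.

(** Every element of a coset represents it, in particular one that lies in K. *)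
Lemma lcosets_meetE {C} : lcosets setT H C -> K `&` C !=set0 ->
  exists2 k, K k & C = lcoset k H.
Proof. by case=> x _ <- [k [Kk /(lcoset_eq subH)]]; exists k. Qed.

Lemma rcosets_meetE {C} : rcosets setT H C -> K `&` C !=set0 ->
  exists2 k, K k & C = rcoset H k.
Proof. by case=> x _ <- [k [Kk /(rcoset_eq subH)]]; exists k. Qed.

(** The trace of C on K is a coset kL. A coset of L in K that meets C does so inside this trace,
    hence shares a point with kL and equals it. *)
Lemma lcoset_met_once C : lcosets setT H C -> K `&` C !=set0 ->
  exists A, [/\ lcosets K L A, K `&` C = A &
                forall B, lcosets K L B -> B `&` C !=set0 -> B = A].
Proof.
move=> HC KC; have [k Kk ->] := lcosets_meetE HC KC.
exists (lcoset k L); split; [by exists k | exact: setI_lcoset |].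
move=> _ [j Kj <-] [z [jz kz]]; rewrite (lcoset_eq subgroupI jz).
apply/esym/(lcoset_eq subgroupI); rewrite -setI_lcoset //; split=> //.
by case: jz => l [_ Kl] <-; exact: (subgroupM subK).
Qed.

Lemma rcoset_met_once C : rcosets setT H C -> K `&` C !=set0 ->
  exists A, [/\ rcosets K L A, K `&` C = A &
                forall B, rcosets K L B -> B `&` C !=set0 -> B = A].
Proof.
move=> HC KC; have [k Kk ->] := rcosets_meetE HC KC.
exists (rcoset L k); split; [by exists k | exact: setI_rcoset |].
move=> _ [j Kj <-] [z [jz kz]]; rewrite (rcoset_eq subgroupI jz).
apply/esym/(rcoset_eq subgroupI); rewrite -setI_rcoset //; split=> //.
by case: jz => l [_ Kl] <-; exact: (subgroupM subK).
Qed.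

(** H absorbs L. Thus [setmulg A H], as a function of A, is the map kL |-> kH written without a
    choice of representative. *)
Lemma setmulg_lcosetI k : setmulg (lcoset k L) H = lcoset k H.
Proof.
apply/seteqP; split=> [_ [_ [l [Hl _] <-] [h Hh <-]]|_ [h Hh <-]].
  by exists (l * h); [exact: (subgroupM subH) | rewrite mulgA].
by exists k; [exact: lcoset_refl subgroupI k | exists h].
Qed.

(** Since khH = kH, every element of KH/H has a representative in K. *)
Lemma lcosets_setmulg : lcosets (setmulg K H) H = lcosets K H.
Proof.
apply/seteqP; split=> _ [x Kx <-]; last first.
  by exists x => //; exists x => //; exists 1; rewrite ?mulg1 //; exact: subgroup1 subH.
case: Kx => k Kk [h Hh <-]; exists k => //.
by apply: (lcoset_eq subH); exists h.
Qed.

Lemma normal_subgroupI : normal_subgroup setT H -> normal_subgroup K L.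
Proof.
case=> _ nH; split=> [|x n Kx [Hn Kn]]; first exact: subgroupI.
split; first exact: nH.
by apply: (subgroupM subK) (subgroupV subK Kx) _; exact: (subgroupM subK).
Qed.

End SubgroupIntersection.

(** * Modules, and the order between blocks *)

Section Modules.
Context {d : Order.disp_t} {T : porderType d}.
Implicit Types X Y M : set T.

(** A point z between a and b but outside M is above a, hence above b by modularity; so z = b, which
    is in M. *)
Lemma module_convex X M : is_module X M -> convex X M.
Proof.
case=> _ modM a b z Ma Mb Xz az zb; have [//|nMz] := pselect (M z).
have [_ /iffLR/(_ az) bz] := modM z a b (conj Xz nMz) Ma Mb.
by rewrite (@le_anti _ _ z b) // zb bz.
Qed.

Lemma moduleI X Y M : Y `<=` X -> is_module X M -> is_module Y (M `&` Y).
Proof.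
move=> YX [_ modM]; split=> [x []//|x m m' [Yx nMx] [Mm _] [Mm' _]].
by apply: modM => //; split; [exact: YX | move=> Mx; apply: nMx].
Qed.

(** Serves for translations: mutually inverse maps of T that carry A into B and B into A restrict to
    the subposets. *)
Lemma subposet_isomorphism {A B : set T} {f g : T -> T} :
  (forall x, A x -> B (f x)) -> (forall x, B x -> A (g x)) ->
  cancel f g -> cancel g f -> {mono f : x y / x <= y} ->
  exists h : subposet A -> subposet B, order_isomorphism h.
Proof.
move=> fAB gBA fK gK mf.
have fP (x : subposet A) : B (f (val x)) by apply/fAB/set_mem/(valP x).
have gP (x : subposet B) : A (g (val x)) by apply/gBA/set_mem/(valP x).
pose h x : subposet B := Sub (f (val x)) (mem_set (fP x)).
pose h' x : subposet A := Sub (g (val x)) (mem_set (gP x)).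
exists h; split; last by move=> x y; rewrite !leEsub !SubK; exact: mf.
by exists h' => x; apply: val_inj; rewrite !SubK ?fK ?gK.
Qed.

(** Between distinct blocks any pair of representatives decides. Equality is a separate case, as two
    points of one block may be incomparable. *)
Lemma block_leP {X} {P : set (set T)} {mP : modular_partition X P}
    (A B : block_quotient mP) a b : val A a -> val B b ->
  A <= B <-> A = B \/ a < b.
Proof.
move=> Aa Bb; rewrite le_eqVlt; split=> [/orP[/eqP|AB]|[->|ab]].
- by left.
- by right; exact: (block_lt_all (AB : block_lt A B)) Aa Bb.
- by rewrite eqxx.
have [->|nAB] := eqVneq A B; first by [].
by apply/andP; split=> //; apply/asboolP; exists a, b.
Qed.

(** Here [A <> B] must be stated, as [a < b] may also hold inside one block. *)
Lemma block_ltP {X} {P : set (set T)} {mP : modular_partition X P}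
    (A B : block_quotient mP) a b : val A a -> val B b ->
  A < B <-> A <> B /\ a < b.
Proof.
move=> Aa Bb; split=> [AB|[/eqP nAB ab]].
  split; last exact: (block_lt_all (AB : block_lt A B)) Aa Bb.
  by move=> eAB; move: AB; rewrite eAB ltxx.
by apply/andP; split=> //; apply/asboolP; exists a, b.
Qed.

End Modules.

(** * Left translations and the modular partition into cosets *)

Section OrderedGroups.
Context {d : Order.disp_t} {G : ogroupType d}.

Lemma lemul2l (a : G) : {mono *%g a : x y / x <= y}.
Proof.
move=> x y; apply/idP/idP; last by move/(mulg_mono a 1); rewrite !mulg1.
by move/(mulg_mono a^-1 1); rewrite !mulg1 !mulKg.
Qed.

Lemma lcosets_modular_partition {P N : set G} :
  subgroup setT P -> subgroup P N -> is_module P N ->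
  modular_partition P (lcosets P N).
Proof.
move=> sP sN [_ modN].
have cosetP x n : P x -> N n -> P (x * n).
  by move=> Px Nn; apply: (subgroupM sP) => //; exact: (subgroup_sub sN).
split.
  split.
  - apply/seteqP; split=> [_ [_ [x Px <-] [n Nn <-]]|x Px]; first exact: cosetP.
    by exists (lcoset x N); [exists x | exact: lcoset_refl sN x].
  - move=> _ _ [x _ <-] [y _ <-] [z [xz yz]].
    by rewrite (lcoset_eq sN xz) (lcoset_eq sN yz).
  - by move=> _ [x _ <-]; exists x; exact: lcoset_refl sN x.
move=> _ [x Px <-]; split=> [_ [n Nn <-]|y _ _ [Py xNy] [m Nm <-] [n Nn <-]].
  exact: cosetP.
(* Translation by [x^-1] turns the comparisons of y with xN into those of [x^-1 * y], a point
   outside N, with the module N. *)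
have Vy : (P `\` N) (x^-1 * y).
  split; first by apply: (subgroupM sP) => //; exact: (subgroupV sP).
  by move=> Nxy; apply: xNy; exists (x^-1 * y); rewrite ?mulVKg.
by rewrite -(mulVKg x y) !lemul2l; exact: modN.
Qed.

End OrderedGroups.

(** * Comparison of the coset quotients of K and G *)

Section CosetQuotients.
Context {d : Order.disp_t} {G : ogroupType d} {H K : set G}.
Context (subH : subgroup setT H) (modH : is_module setT H).
Context (subK : subgroup setT K).
Local Notation L := (H `&` K).

Section Blocks.
Context {mH : modular_partition setT (lcosets setT H)}.
Context {mL : modular_partition K (lcosets K L)}.
Local Notation I :=
  (subposet [set C : block_quotient mH | K `&` val C !=set0]).

Lemma met_blockE (C : I) : exists2 k, K k & val (val C) = lcoset k H.
Proof.
apply: (lcosets_meetE subH (set_mem (valP (val C)))).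
exact: set_mem (valP C).
Qed.

Lemma coset_quotient_isomorphism : exists f : block_quotient mL -> I,
  (forall k A, K k -> val A = lcoset k L -> val (val (f A)) = lcoset k H) /\
  order_isomorphism f.
Proof.
have repL (A : block_quotient mL) : exists2 k, K k & val A = lcoset k L.
  by have [k Kk <-] := set_mem (valP A); exists k.
(* The map sends A to AH; its inverse, built next, sends C to its trace on K. *)
have fex (A : block_quotient mL) :
    exists C : I, val (val C) = setmulg (val A) H.
  have [k Kk eA] := repL A.
  have HC : lcosets setT H (setmulg (val A) H).
    by rewrite eA setmulg_lcosetI //; exists k.
  pose C : block_quotient mH := exist _ (setmulg (val A) H) (mem_set HC).
  have KC : K `&` val C !=set0.
    exists k; split=> //; rewrite /= eA setmulg_lcosetI //.
    exact: lcoset_refl subH k.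
  by exists (exist _ C (mem_set KC)).
have gex (C : I) : exists A : block_quotient mL, val A = K `&` val (val C).
  have [k Kk eC] := met_blockE C.
  have LA : lcosets K L (K `&` val (val C)).
    by rewrite eC setI_lcoset //; exists k.
  by exists (exist _ (K `&` val (val C)) (mem_set LA)).
have [f fE] := choice fex; have [g gE] := choice gex.
have fK : cancel f g.
  move=> A; apply: val_inj; have [k Kk eA] := repL A.
  by rewrite gE fE eA setmulg_lcosetI // setI_lcoset.
have gK : cancel g f.
  move=> C; apply/val_inj/val_inj; have [k Kk eC] := met_blockE C.
  by rewrite fE gE eC setI_lcoset // setmulg_lcosetI.
exists f; split; first by move=> k A _ eA; rewrite fE eA setmulg_lcosetI.
split; first by exists g.
move=> A B; have [[a Ka eA] [b Kb eB]] := (repL A, repL B).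
(* The same a and b represent A and B as well as their images, so both orders reduce to equality of
   blocks or [a < b]. *)
have Aa : val A a by rewrite eA; exact: lcoset_refl (subgroupI subH subK) a.
have Bb : val B b by rewrite eB; exact: lcoset_refl (subgroupI subH subK) b.
have fAa : val (val (f A)) a.
  by rewrite fE eA setmulg_lcosetI //; exact: lcoset_refl subH a.
have fBb : val (val (f B)) b.
  by rewrite fE eB setmulg_lcosetI //; exact: lcoset_refl subH b.
rewrite leEsub; apply/idP/idP.
  move/(block_leP fAa fBb) => [/val_inj/(can_inj fK) ->|ab] //.
  by apply/(block_leP Aa Bb); right.
move/(block_leP Aa Bb) => [->|ab] //.
by apply/(block_leP fAa fBb); right.
Qed.

Lemma coset_lexicographical_sum :
  is_lexicographical_sum K (fun C : I => K `&` val (val C)).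
Proof.
split=> [C|C D _ _ [x [[_ Cx] [_ Dx]]]||C D x y [Kx Cx] [Ky Dy]].
- exact: set_mem (valP C).
- exact/val_inj/(block_eq Cx Dx).
- apply/seteqP; split=> [x [C _ []//]|k Kk].
  have HC : lcosets setT H (lcoset k H) by exists k.
  have kC := lcoset_refl subH k.
  pose C : block_quotient mH := exist _ (lcoset k H) (mem_set HC).
  have KC : K `&` val C !=set0 by exists k.
  by exists (exist _ C (mem_set KC)).
have [<-|/eqP nCD] := eqVneq C D; first by split; [left | case; case].
have nCD' : val C <> val D by move/val_inj.
rewrite ltEsub; split=> [xy|[[//]|[_ CD]]].
  right; split=> //; apply/(block_ltP Cx Dy); split=> //.
  (* The inequality is strict: if x = y, two distinct blocks would share a point. *)
  rewrite lt_neqAle xy andbT; apply/eqP => exy; apply: nCD'.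
  by apply: (block_eq Cx); rewrite exy.
by have [_ /ltW] := (block_ltP Cx Dy).1 CD.
Qed.

(** The trace of C is kL, onto which left translation by k carries L. *)
Lemma met_block_isomorphism (C : I) :
  exists g : subposet L -> subposet (K `&` val (val C)), order_isomorphism g.
Proof.
have [k Kk ->] := met_blockE C; rewrite setI_lcoset //.
apply: (@subposet_isomorphism _ _ _ _ ( *%g k) ( *%g k^-1)).
- by move=> l Ll; exists l.
- by move=> _ [l Ll <-]; rewrite mulKg.
- exact: mulKg.
- exact: mulVKg.
- exact: lemul2l.
Qed.

End Blocks.

Section Normal.
Context {cH : convex_normal_subgroup setT H}.
Context {cL : convex_normal_subgroup K L}.

Lemma ordered_quotient_embedding :
  exists f : ordered_quotient cL -> ordered_quotient cH,
  [/\ forall k A, K k -> val A = lcoset k L -> val (f A) = lcoset k H,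
      ogroup_embedding f &
      [set val C | C in range f] = lcosets (setmulg K H) H].
Proof.
have fex (A : ordered_quotient cL) :
    exists C : ordered_quotient cH, val C = setmulg (val A) H.
  have [k Kk eA] := quotient_repr A.
  have HC : lcosets setT H (setmulg (val A) H).
    by rewrite eA setmulg_lcosetI //; exists k.
  by exists (exist _ (setmulg (val A) H) (mem_set HC)).
have [f f_setmulg] := choice fex.
have fE k A : val A = lcoset k L -> val (f A) = lcoset k H.
  by move=> eA; rewrite f_setmulg eA setmulg_lcosetI.
exists f; split.
- by move=> k A _; exact: fE.
- split.
  + move=> A B eAB; apply: val_inj.
    have [[a Ka eA] [b Kb eB]] := (quotient_repr A, quotient_repr B).
    (* A is recovered from its image as the trace of that image on K. *)
    by rewrite eA eB -!setI_lcoset // -(fE _ _ eA) -(fE _ _ eB) eAB.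
  + move=> A B; apply: val_inj.
    have [[a Ka eA] [b Kb eB]] := (quotient_repr A, quotient_repr B).
    have eAB : val (A * B) = lcoset (a * b) L.
      by rewrite [LHS]val_quotient_mul eA eB (setmulg_lcoset cL).
    rewrite (fE _ _ eAB) [RHS]val_quotient_mul (fE _ _ eA) (fE _ _ eB).
    by rewrite (setmulg_lcoset cH).
  + move=> A B.
    have [[a Ka eA] [b Kb eB]] := (quotient_repr A, quotient_repr B).
    apply/(quotient_leP I I (fE _ _ eA) (fE _ _ eB))/(quotient_leP Ka Kb eA eB).
      (* The element h need not lie in K, so a witness in L has to replace it: [b^-1 * a] in the
         first case, 1 in the second. *)
      case=> h Hh abh; have [Hba|nHba] := pselect (H (b^-1 * a)).
        exists (b^-1 * a); last by rewrite mulVKg.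
        split=> //; apply: (subgroupM subK) => //; exact: (subgroupV subK).
      exists 1; first exact: subgroup1 (subgroupI subH subK).
      have [_ modN] := modH.
      have [/iffLR le1 _] := modN _ _ _ (conj I nHba) Hh (subgroup1 subH).
      by rewrite -(mulVKg b a) lemul2l le1 // -(lemul2l b) mulVKg.
    (* Conversely, a witness in L is already one in H. *)
    by case=> l [Hl _]; exists l.
- rewrite lcosets_setmulg //; apply/seteqP; split=> [_ [_ [A _ <-] <-]|_ [k Kk <-]].
    by have [k Kk eA] := quotient_repr A; exists k => //; rewrite (fE _ _ eA).
  have LA : lcosets K L (lcoset k L) by exists k.
  pose A : ordered_quotient cL := exist _ (lcoset k L) (mem_set LA).
  by exists (f A); [exists A | exact: fE].
Qed.

End Normal.

End CosetQuotients.

Theorem theorem5p1 (d : Order.disp_t) (G : ogroupType d) (H K : set G)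
    (subH : subgroup setT H) (modH : is_module setT H) (subK : subgroup setT K) :
  let L := H `&` K in
  (* (a) *)
  [/\ subgroup K L, convex K L & is_module K L] /\
  (* (b) *)
  [/\ forall k, K k -> K `&` lcoset k H = lcoset k L,
      forall k, K k -> K `&` rcoset H k = rcoset L k,
      forall C, lcosets setT H C -> K `&` C !=set0 ->
        exists A, [/\ lcosets K L A, K `&` C = A &
                      forall B, lcosets K L B -> B `&` C !=set0 -> B = A] &
      forall C, rcosets setT H C -> K `&` C !=set0 ->
        exists A, [/\ rcosets K L A, K `&` C = A &
                      forall B, rcosets K L B -> B `&` C !=set0 -> B = A]] /\
  (* (c) *)
  (exists (mH : modular_partition setT (lcosets setT H))
          (mL : modular_partition K (lcosets K L)),
    let I := subposet [set C : block_quotient mH | K `&` val C !=set0] in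
    [/\ exists f : block_quotient mL -> I,
          (forall k A, K k -> val A = lcoset k L ->
             val (val (f A)) = lcoset k H) /\
          order_isomorphism f,
        is_lexicographical_sum K (fun C : I => K `&` val (val C)) &
        forall C : I, exists g : subposet L -> subposet (K `&` val (val C)),
          order_isomorphism g]) /\
  (* (d) *)
  (normal_subgroup setT H ->
    normal_subgroup K L /\
    exists (cH : convex_normal_subgroup setT H)
           (cL : convex_normal_subgroup K L)
           (f : ordered_quotient cL -> ordered_quotient cH),
      [/\ forall k A, K k -> val A = lcoset k L -> val (f A) = lcoset k H,
          ogroup_embedding f &
          [set val C | C in range f] = lcosets (setmulg K H) H]).
Proof.
move=> L; have subL : subgroup K L by exact: subgroupI.
have modL : is_module K L by exact: moduleI modH.
have cvxL := module_convex modL.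
split; first by split.
split.
  split.
  - exact: setI_lcoset.
  - exact: setI_rcoset.
  - exact: lcoset_met_once.
  - exact: rcoset_met_once.
split.
  have subT : subgroup (@setT G) setT by exact: subgroup_intro.
  have mH := lcosets_modular_partition subT subH modH.
  have mL := lcosets_modular_partition subK subL modL.
  exists mH, mL => I; split.
  - exact: coset_quotient_isomorphism.
  - exact: coset_lexicographical_sum.
  - exact: met_block_isomorphism.
move=> nH; have nL : normal_subgroup K L by exact: normal_subgroupI.
split=> //.
(* Modularity supplies the convexity that makes the quotient order antisymmetric. *)
have cH : convex_normal_subgroup setT H.
  by split; [exact: subgroup_intro | | exact: module_convex].
have cL : convex_normal_subgroup K L by [].
by exists cH, cL; exact: ordered_quotient_embedding.
Qed.
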